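(* Let $g(\theta)=\frac1N\sum_{i=1}^Ng_i(\theta)$, where each $g_i:\mathbb R^d\to\mathbb R$ is continuously differentiable, and suppose that $\liminf_{\|\theta\|\to\infty}\|\nabla g(\theta)\|>0$. Let $G_n$ be the stochastic gradient obtained at $\theta_n$ by uniformly sampling a mini-batch of a fixed size, with or without replacement. Then for every $\rho>0$ the local conditional relative-moment condition holds: there exist $\delta_0>0$ and $\kappa_\rho<\infty$ such that, with $\mathcal L_n:=\{\|\nabla g(\theta_n)\|\le\delta_0\}$, almost surely for every $n\ge1$, $$\mathbf 1_{\mathcal L_n}\mathbb E[\|G_n\|^{2+\rho}\mid\mathscr F_{n-1}]\le\kappa_\rho\mathbf 1_{\mathcal L_n}\mathbb E[\|G_n\|^2\mid\mathscr F_{n-1}].$$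
   Context: $\{\mathscr F_n\}_{n\ge0}$ is a filtration on a probability space; for each $n\ge1$ the iterate $\theta_n\in\mathbb R^d$ is $\mathscr F_{n-1}$-measurable and $G_n$ is $\mathscr F_n$-measurable. The mini-batch stochastic gradient is $G_n=\frac1b\sum_{i\in\mathcal B_n}\nabla g_i(\theta_n)$, where $b$ is a fixed batch size and, conditionally on $\mathscr F_{n-1}$, $\mathcal B_n$ is a uniformly sampled batch of $b$ indices from $\{1,\dots,N\}$, either without replacement ($b\le N$) or with replacement (repeated indices counted with multiplicity). As a standing convention, $g$ is bounded below. $\|\cdot\|$ is the Euclidean norm. *)

(* Defs.v *)
(* MathComp-Analysis; vectors of R^d are row vectors 'rV[R]_d. *)
From HB Require Import structures.
From mathcomp Require Export all_boot all_order all_algebra.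
From mathcomp Require Export all_classical all_reals all_analysis measurable_realfun.
Export Order.TTheory GRing.Theory Num.Theory.
Export numFieldNormedType.Exports.

Set Implicit Arguments.
Unset Strict Implicit.
Unset Printing Implicit Defensive.

Global Open Scope classical_set_scope.
Global Open Scope ring_scope.

(* The library norm `|x| on 'rV[R]_d is the sup norm.  Its topology is the
   Euclidean one, so differentiability and continuity are the usual notions. *)
Definition enorm (R : realType) (d : nat) (x : 'rV[R]_d) : R :=
  Num.sqrt (\sum_(j < d) x 0 j ^+ 2).

Definition gradient (R : realType) (d : nat) (f : 'rV[R]_d -> R)
    (x : 'rV[R]_d) : 'rV[R]_d :=
  \row_(j < d) 'D_(delta_mx 0 j) f x.

Definition C1 (R : realType) (d : nat) (f : 'rV[R]_d -> R) : Prop :=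
  (forall x, differentiable f x) /\ continuous (gradient f).

Definition average (R : realType) (d N : nat) (g_ : 'I_N -> 'rV[R]_d -> R)
    (x : 'rV[R]_d) : R :=
  N%:R^-1 * \sum_(i < N) g_ i x.

(* The filter of "enorm x tends to +oo". *)
Definition enorm_infty (R : realType) (d : nat) : set_system 'rV[R]_d :=
  [set A | exists M : R, forall x, M <= enorm x -> A x].

Definition borel_rV (R : realType) (d : nat) :=
  g_sigma_algebraType (@open 'rV[R]_d).

Section probability_notions.
Context (dsp : measure_display) (T : measurableType dsp) (R : realType).

Definition filtration (F : nat -> set (set T)) : Prop :=
  [/\ forall n, sigma_algebra setT (F n),
      forall n, F n `<=` measurable &
      forall m n, (m <= n)%N -> F m `<=` F n].

(* For a sigma-algebra H, measurability on g_sigma_algebraType H is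
   H-measurability. *)
Definition rV_measurable_wrt (d : nat) (H : set (set T)) (X : T -> 'rV[R]_d)
    : Prop :=
  measurable_fun [set: g_sigma_algebraType H]
    (X : g_sigma_algebraType H -> borel_rV R d).

(* Z is a version of E[X | H] for X >= 0.  X need not be integrable: both
   sides of the defining identity live in [0, +oo].  Such a Z exists and is
   unique up to P-almost sure equality. *)
Definition cond_exp_version (P : probability T R) (H : set (set T))
    (X Z : T -> \bar R) : Prop :=
  [/\ measurable_fun [set: g_sigma_algebraType H]
        (Z : g_sigma_algebraType H -> \bar R),
      forall w, (0 <= Z w)%E &
      forall A, H A -> (\int[P]_(w in A) Z w = \int[P]_(w in A) X w)%E].

(* Conditionally on H, the random element B of I is uniform on S, i.e.
   P(B = c | H) = 1_S(c) / #|S| for all c. *)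
Definition cond_uniform (P : probability T R) (H : set (set T))
    (I : finType) (S : {pred I}) (B : T -> I) : Prop :=
  forall c : I, measurable (B @^-1` [set c]) /\
    cond_exp_version P H (fun w => (\1_(B @^-1` [set c]) w)%:E)
      (fun=> ((c \in S)%:R / #|S|%:R)%:E).

(* Without replacement the batch is a uniform b-element subset of 'I_N. *)
Definition minibatch_without_replacement (P : probability T R)
    (F : nat -> set (set T)) (d N b : nat) (g_ : 'I_N -> 'rV[R]_d -> R)
    (theta G : nat -> T -> 'rV[R]_d) : Prop :=
  (b <= N)%N /\
  exists B : nat -> T -> {set 'I_N}, forall n, (0 < n)%N ->
    cond_uniform P (F n.-1) [pred c : {set 'I_N} | #|c| == b] (B n) /\
    forall w, G n w =
      b%:R^-1 *: \sum_(i in B n w) gradient (g_ i) (theta n w).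

(* With replacement the batch is a uniform b-tuple, i.e. b independent uniform
   draws; repeated indices are counted with multiplicity. *)
Definition minibatch_with_replacement (P : probability T R)
    (F : nat -> set (set T)) (d N b : nat) (g_ : 'I_N -> 'rV[R]_d -> R)
    (theta G : nat -> T -> 'rV[R]_d) : Prop :=
  exists B : nat -> T -> b.-tuple 'I_N, forall n, (0 < n)%N ->
    cond_uniform P (F n.-1) (fun=> true) (B n) /\
    forall w, G n w =
      b%:R^-1 *: \sum_(k < b) gradient (g_ (tnth (B n w) k)) (theta n w).

End probability_notions.

(* Main.v *)
Require Import Defs.

(** The condition is local, and this makes it a statement about boundedness.
    Since the liminf of the gradient norm at infinity is positive, a level
    delta0 below it confines every point where the gradient of g has norm at
    most delta0 to a ball of some radius M [limf_einf_enorm_gt0].  A mini-batch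
    gradient is, whichever batch is drawn and under either sampling scheme, one
    of finitely many continuous functions of the current iterate
    [minibatch_finite_family]; these are bounded on the ball by a common K, by
    compactness [finite_family_bounded].  Hence, as long as theta_n lies in the
    ball, |G_n| <= K and

      |G_n|^(2 + rho) = |G_n|^rho * |G_n|^2 <= K^rho * |G_n|^2

    pointwise, with a constant that depends neither on n nor on the batch.

    It remains to take conditional expectations.  The event that theta_n lies in
    the ball belongs to F_(n-1), so monotonicity of the conditional expectation
    can be used on that event alone [cond_exp_version_le].  Outside of it G_n
    need not be integrable, so monotonicity is proved for nonnegative functions
    whose integral is only known to be finite on the event considered. *)

(** * Euclidean space *)

Section euclidean_space.
Set Implicit Arguments.
Unset Strict Implicit.
Context (R : realType) (d : nat).
Implicit Types x : 'rV[R]_d.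

Lemma continuous_sum (V : normedModType R) (U : topologicalType)
    (I : finType) (A : pred I) (f : I -> U -> V) :
  (forall i, continuous (f i)) -> continuous (fun u : U => \sum_(i | A i) f i u).
Proof.
move=> fcont; apply: (continuous_big (op := +%R)) => [|i _].
  exact: add_continuous.
exact: fcont.
Qed.

Lemma enorm_ge0 x : 0 <= enorm x.
Proof. exact: sqrtr_ge0. Qed.

Lemma enorm_continuous : continuous (@enorm R d).
Proof.
move=> x; apply: (@continuous_comp _ _ _
  (fun x : 'rV[R]_d => \sum_(j < d) x 0 j ^+ 2) (@Num.sqrt R)); last first.
  exact: sqrt_continuous.
apply: (continuous_sum (V := R)) => j {}x.
apply: (@continuous_comp _ _ _ (fun x : 'rV[R]_d => x 0 j)
  (fun y : R => y ^+ 2)).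
  exact: coord_continuous.
exact: exprn_continuous.
Qed.

Lemma measurable_enorm :
  measurable_fun [set: borel_rV R d] (@enorm R d : borel_rV R d -> R).
Proof.
apply: (measurability _ (RGenOpens.measurableE R)).
move=> _ [_ [a [b ->] <-]].
rewrite setTI; apply: sub_sigma_algebra.
apply: (@open_comp _ _ (@enorm R d)); last exact: interval_open.
by move=> x _; exact: enorm_continuous.
Qed.

Lemma coord_le_enorm x j : `|x 0 j| <= enorm x.
Proof.
rewrite -sqrtr_sqr ler_wsqrtr// (bigD1 j)//= lerDl.
by apply: sumr_ge0 => i _; exact: sqr_ge0.
Qed.

Lemma open_enorm_lt (M : R) : open [set x : 'rV[R]_d | enorm x < M].
Proof.
apply: (@open_comp _ _ (@enorm R d) [set y | y < M]); last exact: open_lt.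
by move=> x _; exact: enorm_continuous.
Qed.

(** The ball of radius M lies in the cube of side 2M, which is compact as a
    product of segments; each of the finitely many continuous norms is bounded
    there, and finitely many bounds have a common one. *)
Lemma finite_family_bounded (I : finType) (h : I -> 'rV[R]_d -> 'rV[R]_d)
    (M : R) : (forall c, continuous (h c)) ->
  exists2 K : R, 0 < K &
    forall c x, enorm x < M -> enorm (h c x) <= K.
Proof.
move=> hcont.
have [K K0 hK] : exists2 K : R, 0 < K &
    forall c x, (forall j, `[- M, M]%classic (x 0 j)) -> `|enorm (h c x)| <= K.
  (* All large enough K work for each c; finiteness of I makes this uniform. *)
  apply: pinfty_ex_gt => //; apply: filter_forall => c.
  have /compact_bounded : compact ((fun x => enorm (h c x)) @`
      [set x : 'rV[R]_d | forall j, `[- M, M]%classic (x ord0 j)]).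
    apply: continuous_compact; last first.
      apply: (@rV_compact R d (fun=> `[- M, M]%classic)) => j.
      exact: segment_compact.
    apply: continuous_subspaceT => x; apply: continuous_comp; first exact: hcont.
    exact: enorm_continuous.
  move=> [B [Breal hB]]; exists B; split=> // K BK x xM.
  by apply: (hB K BK); exists x.
exists K => // c x xM; rewrite -[leLHS]ger0_norm ?enorm_ge0//.
apply: hK => j; rewrite /= in_itv/= -ler_norml.
by rewrite (le_trans (coord_le_enorm x j))// ltW.
Qed.

(** A positive liminf exceeds some delta > 0 uniformly on a neighbourhood of
    infinity, so the sublevel set at height delta is bounded. *)
Lemma limf_einf_enorm_gt0 (f : 'rV[R]_d -> R) :
  (0 < limf_einf (fun x => (f x)%:E) (@enorm_infty R d))%E ->
  exists delta M : R, 0 < delta /\ forall x, f x <= delta -> enorm x < M.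
Proof.
rewrite limf_einfE => /ereal_sup_gt[_ [A [M hM] <-]] /=.
set m := ereal_inf _ => m0.
(* The infimum m is +oo when A is empty, which happens for d = 0. *)
have [delta d0 dm] : exists2 delta : R, 0 < delta & (delta%:E < m)%E.
  case: (m) m0 => [r| |]//.
    rewrite lte_fin => r0; exists (r / 2); first exact: divr_gt0.
    by rewrite lte_fin gtr_pMr// invf_lt1// ltr1n.
  by exists 1; rewrite ?ltry.
exists delta, M; split => // x; apply: contraTT; rewrite -leNgt -ltNge => /hM Ax.
rewrite -lte_fin (lt_le_trans dm)//.
by apply: ereal_inf_lbound; exists x.
Qed.

Lemma powR_2D_le (a K rho : R) : 0 <= a -> a <= K -> 0 < rho ->
  a `^ (2 + rho) <= K `^ rho * a ^+ 2.
Proof.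
move=> a0 aK rho0.
have K0 : 0 <= K by exact: le_trans aK.
rewrite powRD; last by rewrite gt_eqF// addr_gt0.
rewrite mulrC powR_mulrn// ler_wpM2r ?sqr_ge0//.
by apply: ge0_ler_powR => //; rewrite ?nnegrE// ltW.
Qed.

End euclidean_space.

(** * Conditional expectations of nonnegative functions *)

Section conditional_expectation.
Set Implicit Arguments.
Unset Strict Implicit.
Context (dsp : measure_display) (T : measurableType dsp) (R : realType).
Implicit Types (P : probability T R) (H : set (set T)) (X Y Z : T -> \bar R).

Lemma measurable_g_sigma_algebra H (A : set (g_sigma_algebraType H)) :
  sigma_algebra setT H -> measurable A -> H A.
Proof. by move=> sH; rewrite /measurable/= sigma_algebra_id. Qed.

(** Versions of a conditional expectation given H are H-measurable by definition,
    while the integrals against P ask for measurability in the ambient space. *)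
Lemma sub_measurable_fun H d' (U : sigmaRingType d') (f : T -> U) :
  sigma_algebra setT H -> H `<=` measurable ->
  measurable_fun [set: g_sigma_algebraType H] (f : g_sigma_algebraType H -> U) ->
  measurable_fun setT f.
Proof.
move=> sH HT mf _ B mB; apply: HT.
by apply: (measurable_g_sigma_algebra sH); exact: mf.
Qed.

(** The part A of D where the inequality fails is H-measurable, and averaging
    X <= k Y over A gives \int_A ZX <= \int_A k ZY < +oo.  But ZX - k ZY > 0 on
    A, so A is negligible.  Finiteness of the integral of Y over D is what allows
    the two integrals to be subtracted. *)
Lemma cond_exp_version_le P H X Y ZX ZY (D : set T) (k : R) :
  sigma_algebra setT H -> H `<=` measurable ->
  cond_exp_version P H X ZX -> cond_exp_version P H Y ZY ->
  measurable_fun setT X -> measurable_fun setT Y ->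
  (forall w, 0 <= X w)%E -> (forall w, 0 <= Y w)%E -> 0 <= k ->
  H D -> (\int[P]_(w in D) Y w < +oo)%E ->
  (forall w, D w -> X w <= k%:E * Y w)%E ->
  {ae P, forall w, D w -> (ZX w <= k%:E * ZY w)%E}.
Proof.
move=> sH HT [mHZX ZX0 ZXE] [mHZY ZY0 ZYE] mX mY X0 Y0 k0 HD Yfin XY.
have mZX := sub_measurable_fun sH HT mHZX.
have mZY := sub_measurable_fun sH HT mHZY.
pose kZY w := (k%:E * ZY w)%E.
have mHkZY : measurable_fun [set: g_sigma_algebraType H]
    (kZY : g_sigma_algebraType H -> \bar R) by exact: measurable_funeM.
have mkZY := sub_measurable_fun sH HT mHkZY.
pose A := D `&` [set w | (kZY w < ZX w)%E].
have HA : H A.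
  apply: (measurable_g_sigma_algebra sH); apply: measurableI.
    exact: sub_sigma_algebra.
  rewrite -[X in measurable X]setTI.
  exact: (@measurable_lte _ (g_sigma_algebraType H) R setT _ kZY ZX).
have mA := HT _ HA.
have mD := HT _ HD.
have mS (f : T -> \bar R) B : measurable_fun setT f -> measurable_fun B f.
  by move=> mf; apply: measurable_funS mf.
have leA : (\int[P]_(w in A) ZX w <= \int[P]_(w in A) kZY w)%E.
  rewrite ZXE// ge0_integralZl_EFin//; last exact: mS.
  rewrite ZYE// -ge0_integralZl_EFin//; last exact: mS.
  apply: ge0_le_integral => //; [exact: mS| |by move=> w [/XY]].
  by apply: mS; exact: measurable_funeM.
have kZYfin : (\int[P]_(w in A) kZY w < +oo)%E.
  rewrite ge0_integralZl_EFin//; last exact: mS.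
  rewrite ZYE// lte_mul_pinfty// ?lee_fin//.
  apply: le_lt_trans Yfin; apply: ge0_subset_integral => //; first exact: mS.
  exact: subIsetl.
have kZY0 w : (0 <= kZY w)%E by rewrite mule_ge0.
have iZX : P.-integrable A ZX.
  apply/integrableP; split; first exact: mS.
  under eq_integral do rewrite gee0_abs//.
  exact: le_lt_trans kZYfin.
have ikZY : P.-integrable A kZY.
  apply/integrableP; split; first exact: mS.
  by under eq_integral do rewrite gee0_abs//.
have diff0 w : A w -> (0 < ZX w - kZY w)%E by move=> [_ /=]; rewrite sube_gt0.
have : (\int[P]_(w in A) `|(ZX \- kZY) w|)%E = 0%E.
  apply/eqP; rewrite eq_le integral_ge0// andbT.
  rewrite (eq_integral (ZX \- kZY)%E); last first.
    by move=> w /set_mem Aw; rewrite gee0_abs// ltW//; exact: diff0.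
  by rewrite integralB// sube_le0.
move/ae_eq_integral_abs => /(_ mA).
move=> /(_ (emeasurable_funB (mS _ _ mZX) (mS _ _ mkZY))).
apply: filterS => w nA Dw; rewrite leNgt; apply/negP => lt_w.
have Aw : A w by [].
by have := diff0 w Aw; rewrite (nA Aw) ltxx.
Qed.

End conditional_expectation.

(** * Mini-batch gradients *)

Section minibatch.
Set Implicit Arguments.
Unset Strict Implicit.

(** Only finitely many batches can be drawn, subsets or tuples of indices, and the
    gradient of each depends continuously on the iterate.  In this form both
    sampling schemes admit the same compactness argument. *)
Lemma minibatch_finite_family (dsp : measure_display) (T : measurableType dsp)
    (R : realType) (P : probability T R) (F : nat -> set (set T)) (d N b : nat)
    (g_ : 'I_N -> 'rV[R]_d -> R) (theta G : nat -> T -> 'rV[R]_d) :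
  (forall i, C1 (g_ i)) ->
  minibatch_without_replacement P F b g_ theta G \/
  minibatch_with_replacement P F b g_ theta G ->
  exists (I : finType) (h : I -> 'rV[R]_d -> 'rV[R]_d),
    (forall c, continuous (h c)) /\
    forall n, (0 < n)%N -> forall w, exists c, G n w = h c (theta n w).
Proof.
move=> hC1.
have hcont (J : finType) (A : pred J) (s : J -> 'I_N) : continuous
    (fun x => b%:R^-1 *: \sum_(j | A j) gradient (g_ (s j)) x : 'rV[R]_d).
  move=> x; apply: continuous_comp; last exact: scaler_continuous.
  apply: (continuous_sum (V := 'rV[R]_d)) => j {}x.
  exact: (hC1 _).2.
move=> [[_ [B hB]]|[B hB]].
  exists {set 'I_N}, (fun (c : {set 'I_N}) x => b%:R^-1 *: \sum_(i in c) gradient (g_ i) x).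
  split=> [c|n n0 w]; first exact: (hcont _ (fun i => i \in c) id).
  by exists (B n w); exact: (hB n n0).2.
exists (b.-tuple 'I_N),
  (fun (c : b.-tuple 'I_N) x => b%:R^-1 *: \sum_(k < b) gradient (g_ (tnth c k)) x).
split=> [c|n n0 w]; first exact: (hcont _ xpredT (tnth c)).
by exists (B n w); exact: (hB n n0).2.
Qed.

End minibatch.

(** * Local relative moments *)

Theorem proposition1 (R : realType) (dsp : measure_display)
    (T : measurableType dsp) (P : probability T R)
    (F : nat -> set (set T)) (d N b : nat)
    (g_ : 'I_N -> 'rV[R]_d -> R) (theta G : nat -> T -> 'rV[R]_d)
    (hN : (0 < N)%N) (hb : (0 < b)%N)
    (hF : filtration F)
    (hC1 : forall i, C1 (g_ i))
    (hbelow : has_lbound (range (average g_)))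
    (hliminf : (0 < limf_einf
       (fun x : 'rV[R]_d => (enorm (gradient (average g_) x))%:E)
       (@enorm_infty R d))%E)
    (htheta : forall n, (0 < n)%N -> rV_measurable_wrt (F n.-1) (theta n))
    (hG : forall n, (0 < n)%N -> rV_measurable_wrt (F n) (G n))
    (hbatch : minibatch_without_replacement P F b g_ theta G \/
              minibatch_with_replacement P F b g_ theta G) :
  forall rho : R, 0 < rho ->
  exists delta0 kappa : R, 0 < delta0 /\
    let L n := [set w | enorm (gradient (average g_) (theta n w)) <= delta0] in
    forall Erho E2 : nat -> T -> \bar R,
    (forall n, (0 < n)%N ->
       cond_exp_version P (F n.-1)
         (fun w => (enorm (G n w) `^ (2 + rho))%:E) (Erho n) /\
       cond_exp_version P (F n.-1)
         (fun w => (enorm (G n w) ^+ 2)%:E) (E2 n)) ->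
    {ae P, forall w, forall n, (0 < n)%N ->
       ((\1_(L n) w)%:E * Erho n w <=
        kappa%:E * ((\1_(L n) w)%:E * E2 n w))%E}.
Proof.
move=> rho rho0.
have [sF FT _] := hF.
have [delta0 [M [delta0_gt0 hM]]] := limf_einf_enorm_gt0 hliminf.
have [I [h [hcont hGh]]] := minibatch_finite_family hC1 hbatch.
have [K K0 hK] := finite_family_bounded M hcont.
exists delta0, (K `^ rho); split => // L Erho E2 hE.
apply: (@ae_foralln _ _ _ P
  (fun n w => (0 < n)%N -> ((\1_(L n) w)%:E * Erho n w <=
        (K `^ rho)%:E * ((\1_(L n) w)%:E * E2 n w))%E)) => n.
have [->|n0] := posnP n; first exact: aeW.
(* L n is contained in the event D, which is easier to see in F (n-1) since it
   is the preimage of an open ball under theta n. *)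
pose D := [set w | enorm (theta n w) < M].
have HD : F n.-1 D.
  apply: (measurable_g_sigma_algebra (sF _)).
  have := htheta n n0 measurableT [set x : 'rV[R]_d | enorm x < M].
  rewrite setTI; apply; apply: sub_sigma_algebra; exact: open_enorm_lt.
have mD : measurable D := FT _ _ HD.
have mG : measurable_fun setT (fun w => enorm (G n w)).
  have mGn := sub_measurable_fun (sF n) (FT n) (hG n n0).
  exact: (measurableT_comp (@measurable_enorm R d) mGn).
have GK w : D w -> enorm (G n w) <= K.
  by move=> Dw; have [c ->] := hGh n n0 w; exact: hK.
have [hErho hE2] := hE n n0.
have mG2 : measurable_fun setT (fun w => (enorm (G n w) ^+ 2)%:E).
  by apply/measurable_EFinP; exact: measurable_funX.
have mGrho : measurable_fun setT (fun w => (enorm (G n w) `^ (2 + rho))%:E).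
  apply/measurable_EFinP.
  exact: (measurableT_comp (measurable_powR (2 + rho)) mG).
have intD : (\int[P]_(w in D) (enorm (G n w) ^+ 2)%:E < +oo)%E.
  apply: (@le_lt_trans _ _ (\int[P]_(w in D) (K ^+ 2)%:E)%E).
    apply: ge0_le_integral => //.
    - by move=> w _; rewrite lee_fin sqr_ge0.
    - exact: measurable_funS mG2.
    - move=> w /GK GwK.
      by rewrite lee_fin lerXn2r// nnegrE ?enorm_ge0// ltW.
  rewrite integral_cst// lte_mul_pinfty ?lee_fin ?sqr_ge0//.
  by rewrite (le_lt_trans (probability_le1 P mD)) ?ltry.
have := cond_exp_version_le (sF _) (FT _) hErho hE2 mGrho mG2 _ _
  (powR_ge0 K rho) HD intD.
move=> /(_ _ _ _)/wrap[|||].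
- by move=> w; rewrite lee_fin powR_ge0.
- by move=> w; rewrite lee_fin sqr_ge0.
- move=> w Dw; rewrite -EFinM lee_fin.
  exact: (powR_2D_le (enorm_ge0 _) (GK w Dw) rho0).
apply: filterS => w hw _.
have [Lw|nLw] := pselect (L n w); last first.
  by rewrite indicE memNset// !mul0e mule0.
by rewrite indicE mem_set// !mul1e; apply: hw; exact: hM.
Qed.
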